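(* Let $G$ be a finite connected general graph (loops and parallel edges allowed) of odd order, and let $f\colon V(G)\to \mathbb{Z}^+$ be a function. Then \[ o(G-S)\le f(S)\qquad\text{for all non-empty vertex subsets } S\subseteq V(G) \] holds if and only if, for every $2$-end-coloring of $G$, either $G$ is $J_f^*$-critical or $G$ contains a colored $J_f^*$-factor.
   Context: For $S\subseteq V(G)$, $o(G-S)$ denotes the number of connected components of odd order of $G-S$, and $f(S)=\sum_{v\in S}f(v)$. A $2$-end-coloring of $G$ assigns to every end of every edge one of two colors, red or green, such that the two ends of each loop receive the same color. For an edge $e$ and a vertex $v$ define $e(v)=2$ if $e$ is a red loop at $v$; $e(v)=-2$ if $e$ is a green loop at $v$; $e(v)=1$ if $e$ is not a loop and $v$ is a red end of $e$; $e(v)=-1$ if $e$ is not a loop and $v$ is a green end of $e$; and $e(v)=0$ if $v$ is not incident with $e$. For a spanning subgraph $F$ of $G$ (with the inherited coloring), the colored degree of $v$ is $\Phi_F(v)=\sum_{e\in E(F)}e(v)$. For each vertex $v$, $J_f^*(v)$ is the set of all odd integers (positive or negative) that are at most $f(v)$, together with $f(v)$ itself. A colored $J_f^*$-factor is a spanning subgraph $F$ with $\Phi_F(v)\in J_f^*(v)$ for all $v$. For a spanning subgraph $F$ let $\mathrm{dist}_F(v)=\min\{|\Phi_F(v)-h|: h\in J_f^*(v)\}$ and $\delta(F)=\sum_{v\in V(G)}\mathrm{dist}_F(v)$. Let $\delta^*=\min\{\delta(F): F \text{ a spanning subgraph of } G\}$; $F$ is called optimal if $\delta(F)=\delta^*$.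 Let $I(v)=\{\Phi_F(v): F \text{ optimal}\}$. Define $C=\{v: I(v)\subseteq J_f^*(v)\}$, $A=\{v\notin C: \min I(v)\ge \max J_f^*(v)\}$, $B=\{v\notin C: \max I(v)\le \inf J_f^*(v)\}$, and $D=V(G)\setminus(A\cup B\cup C)$. The graph $G$ is called $J_f^*$-critical (for the given coloring) if it is connected and $D=V(G)$. *)

(* Defs.v *)
From HB Require Import structures.
From mathcomp Require Import all_boot all_order all_algebra.
From mathcomp Require Import boolp classical_sets.

Set Implicit Arguments.
Unset Strict Implicit.
Unset Printing Implicit Defensive.

Import Order.TTheory GRing.Theory Num.Theory.
Local Open Scope ring_scope.

(* A finite general graph: loops and parallel edges are allowed.  Every edge
   has two ends, indexed by [bool]; the indexing carries no orientation. *)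
Record graph := Graph {
  vertex : finType;
  edge : finType;
  endpt : edge -> bool -> vertex
}.

Section Graph.
Variable G : graph.
Implicit Types (u v w : vertex G) (e : edge G) (S : {set vertex G}).

Definition is_loop e : bool := endpt e true == endpt e false.

Definition adjacent : rel (vertex G) := fun u w =>
  [exists e, exists i, (endpt e i == u) && (endpt e (~~ i) == w)].

Definition connected_graph : Prop := forall u w, connect adjacent u w.

Definition adjacent_minus S : rel (vertex G) := fun u w =>
  [&& u \notin S, w \notin S & adjacent u w].

Definition components_minus S : {set {set vertex G}} :=
  equivalence_partition (connect (adjacent_minus S)) (~: S).

Definition odd_components S : nat :=
  #|[set K in components_minus S | odd #|K|]|.

End Graph.

Inductive color := Red | Green.

Definition color_sign (k : color) : int := if k is Red then 1 else -1.

Definition two_end_coloring (G : graph) (c : edge G -> bool -> color) : Prop :=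
  forall e : edge G, is_loop e -> c e true = c e false.

Section ColoredFactors.
Variables (G : graph) (c : edge G -> bool -> color) (f : vertex G -> nat).
Implicit Types (v : vertex G) (e : edge G).

Definition end_value e v : int :=
  if is_loop e then
    if endpt e true == v then 2 * color_sign (c e true) else 0
  else if endpt e true == v then color_sign (c e true)
  else if endpt e false == v then color_sign (c e false)
  else 0.

(* A spanning subgraph is given by its set of edges. *)
Definition colored_degree (F : {set edge G}) v : int :=
  \sum_(e in F) end_value e v.

Definition Jstar v : set int :=
  [set h : int | (odd `|h|%N /\ h <= (f v)%:Z) \/ h = (f v)%:Z]%classic.

Definition colored_factor (F : {set edge G}) : Prop :=
  forall v, Jstar v (colored_degree F v).

Definition dist_value F v (d : nat) : bool :=
  `[< exists2 h : int, Jstar v h & d = `|colored_degree F v - h|%N >].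

Fact dist_value_ex F v : exists d, dist_value F v d.
Proof.
exists `|colored_degree F v - (f v)%:Z|%N; apply/asboolP.
by exists (f v)%:Z => //; right.
Qed.

Definition dist F v : nat := ex_minn (dist_value_ex F v).

Definition deficiency F : nat := (\sum_v dist F v)%N.

Definition min_deficiency : nat :=
  deficiency [arg min_(F < (finset.set0 : {set edge G})) deficiency F].

Definition optimal F : Prop := deficiency F = min_deficiency.

Definition Iset v : set int :=
  [set x | exists2 F, optimal F & x = colored_degree F v]%classic.

Definition is_min (X : set int) (m : int) : Prop :=
  X m /\ forall x, X x -> m <= x.

Definition is_max (X : set int) (m : int) : Prop :=
  X m /\ forall x, X x -> x <= m.

(* [m <= inf X] in the extended integers, where [inf X] is [-oo] when [X] is
   unbounded below; this is always so for [X = Jstar v], whence [Bset] is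
   empty. *)
Definition le_inf (m : int) (X : set int) : Prop := forall x, X x -> m <= x.

Definition Cset : set (vertex G) := [set v | Iset v `<=` Jstar v]%classic.

Definition Aset : set (vertex G) :=
  [set v | ~ Cset v /\
     exists m M, [/\ is_min (Iset v) m, is_max (Jstar v) M & M <= m]]%classic.

Definition Bset : set (vertex G) :=
  [set v | ~ Cset v /\
     exists2 M, is_max (Iset v) M & le_inf M (Jstar v)]%classic.

Definition Dset : set (vertex G) := (~` (Aset `|` Bset `|` Cset))%classic.

Definition Jstar_critical : Prop :=
  connected_graph G /\ Dset = classical_sets.setT.

End ColoredFactors.

(* Main.v *)
(* Colored degree sequences form a constant-parity jump system, so two edge sets
   can be exchanged two steps at a time; this yields the Gallai-Edmonds theory of
   the total distance to J*, here called cost.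

   Suppose there is no factor.  Give the vertices of a set T the linear cost
   [x - f v], which may be negative.  As long as some vertex outside T always has
   degree at least [f] in optimal edge sets, and sometimes more, it can be added
   to T without lowering the minimum cost.  For a maximal T of positive minimum
   cost, every component of G - T has either no deficient vertex or only
   deficient ones, and in the latter case its cost is at most 1 (Gallai's
   lemma).  Edges from T to a component can be flipped at no loss, and a parity
   count bounds the minimum cost by o(G - T) - f(T).  Hence T is empty, and G is
   critical by connectivity.

   Conversely, if o(G - S) > f(S), color the ends in S red and the others green.
   The same parity count bounds every cost below by o(G - S) - f(S) >= 1, so
   there is no factor; and if G were critical the minimum cost would be 1, which
   forces degree at least [f] on S in all optimal edge sets, a contradiction. *)

Require Import Defs.
From mathcomp Require Import all_boot all_order all_algebra.
From mathcomp Require Import zify.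
From mathcomp Require boolp.

Set Implicit Arguments.
Unset Strict Implicit.
Unset Printing Implicit Defensive.

Section CostMinimisation.
Import Order.TTheory GRing.Theory Num.Theory.
Local Open Scope ring_scope.

Variables (G : graph) (c : edge G -> bool -> color) (f : vertex G -> nat).
Hypothesis c_ok : two_end_coloring c.
Implicit Types (F : {set edge G}) (T X Y K : {set vertex G}).
Implicit Types (e : edge G) (u v z p a : vertex G) (s t : int) (i : bool).

Local Notation Phi := (colored_degree c).

(** * Edge flips and the exchange property *)

Definition is_unit_step s : Prop := s = 1 \/ s = -1.

Definition flip F e : {set edge G} := if e \in F then F :\ e else e |: F.

Definition flip_sign F e i : int :=
  if e \in F then - color_sign (c e i) else color_sign (c e i).

(** The size of the symmetric difference, the measure of the exchange inductions below. *)
Definition gap F F' : nat := #|[set e | (e \in F) != (e \in F')]|.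

Definition shift (x : vertex G -> int) p s : vertex G -> int :=
  fun u => if u == p then x u + s else x u.

Lemma color_sign_unit (k : color) : is_unit_step (color_sign k).
Proof. by case: k; [left | right]. Qed.

Lemma flip_sign_unit F e i : is_unit_step (flip_sign F e i).
Proof.
by rewrite /flip_sign; case: ifP; case: (c e i); by [left | right].
Qed.

Lemma in_flip F e e' : (e' \in flip F e) = (e' \in F) (+) (e' == e).
Proof.
by rewrite /flip; case: ifP => eF; rewrite !inE; case: eqVneq => [-> | _] /=;
  rewrite ?eF ?addbF.
Qed.

(** Summing over both ends treats loops uniformly: the two ends of a loop share a color, so they add
    up to 2 or -2. *)
Lemma end_valueE e v i : end_value c e v =
  (endpt e i == v)%:Z * color_sign (c e i)
  + (endpt e (~~ i) == v)%:Z * color_sign (c e (~~ i)).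
Proof.
have H := @c_ok e; rewrite /end_value; move: H; rewrite /is_loop.
case: eqVneq => [E /(_ isT) H | ne _].
  by case: i; rewrite /= E H mulr_natl mulr2n; move: (color_sign _) => k;
    case: eqP => _ /=; lia.
have : ~~ ((endpt e true == v) && (endpt e false == v)).
  by apply: contra ne => /andP [/eqP -> /eqP ->].
by case: i => /=; move: (color_sign _) (color_sign _) => k k';
  case: (endpt e true == v); case: (endpt e false == v) => //= _; lia.
Qed.

Lemma colored_degree_sum F v :
  Phi F v = \sum_e (e \in F)%:Z * end_value c e v.
Proof.
rewrite /colored_degree big_mkcond /=; apply: eq_bigr => e _.
by case: (e \in F); rewrite ?mul1r ?mul0r.
Qed.

Lemma colored_degree_flip F e i : Phi (flip F e) =1
  shift (shift (Phi F) (endpt e i) (flip_sign F e i))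
        (endpt e (~~ i)) (flip_sign F e (~~ i)).
Proof.
move=> v.
have -> : Phi (flip F e) v = Phi F v +
    (if e \in F then - end_value c e v else end_value c e v).
  rewrite /colored_degree /flip; case: ifP => eF.
    by rewrite [in RHS](big_setD1 e eF) /= addrAC subrr add0r.
  by rewrite big_setU1 ?eF //= addrC.
rewrite (end_valueE e v i) /shift /flip_sign !(eq_sym v).
move: (color_sign _) (color_sign _) => k k'.
by case: ifP => _; do 2 case: eqP => _ /=; lia.
Qed.

Lemma gapC F F' : gap F F' = gap F' F.
Proof. by apply: eq_card => e; rewrite !inE eq_sym. Qed.

Lemma gap_flip F F' e :
  (e \in F) != (e \in F') -> (gap (flip F e) F' < gap F F')%N.
Proof.
move=> ne; rewrite /gap (cardD1 e [set e0 | (e0 \in F) != (e0 \in F')]).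
rewrite inE ne add1n ltnS; apply: subset_leq_card; apply/subsetP => e'.
rewrite !inE in_flip; case: (eqVneq e' e) => [-> | _]; last by rewrite addbF.
by move: ne; case: (e \in F); case: (e \in F').
Qed.

(** If no end at [v] in the symmetric difference offered the step [s], every edge would contribute a
    nonpositive term to [s * (Phi F' v - Phi F v)]. *)
Lemma exists_flip F F' v s : is_unit_step s -> 0 < s * (Phi F' v - Phi F v) ->
  exists e i, [/\ (e \in F) != (e \in F'), endpt e i = v & flip_sign F e i = s].
Proof.
move=> us pos; apply: boolp.contrapT => nex; move: pos; apply/negP.
rewrite -leNgt !colored_degree_sum -sumrB mulr_sumr; apply: sumr_le0 => e _.
have H i : s * (((e \in F')%:Z - (e \in F)%:Z)
                * ((endpt e i == v)%:Z * color_sign (c e i))) <= 0.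
  case: (boolP ((e \in F) == (e \in F'))) => [/eqP -> | ne].
    by rewrite subrr mul0r mulr0.
  case: eqP => [ev | _]; last by rewrite mul0r !mulr0.
  have : flip_sign F e i <> s by move=> es; apply: nex; exists e, i.
  move: us ne (color_sign_unit (c e i)); rewrite /flip_sign /is_unit_step.
  move: (color_sign _) => k.
  case: (e \in F); case: (e \in F') => //= [] [] -> _; lia.
rewrite -mulrBl (end_valueE e v true) mulrDr mulrDr.
by have := H true; have := H false; rewrite /=; lia.
Qed.

(* The two-step axiom of constant-parity jump systems. *)
Lemma exchange F F' v s : is_unit_step s -> 0 < s * (Phi F' v - Phi F v) ->
  exists F'' p t, [/\ is_unit_step t,
    Phi F'' =1 shift (shift (Phi F) v s) p t,
    0 < t * (Phi F' p - shift (Phi F) v s p) & (gap F'' F' < gap F F')%N].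
Proof.
have [n] := ubnP (gap F F'); elim: n F v s => // n IH F v s /ltnSE len us pos.
have [e [i [ne ev es]]] := exists_flip us pos.
set w := endpt e (~~ i); set t := flip_sign F e (~~ i).
have ut : is_unit_step t by apply: flip_sign_unit.
have E := colored_degree_flip F e i; rewrite ev es -/w -/t in E.
have lt := gap_flip ne.
(* The flip moves [w] by [t]. If this is not toward [F'], the induction hypothesis for [flip F e]
   undoes it by the step [- t] at [w] and supplies the second step. *)
case: (ltP 0 (t * (Phi F' w - shift (Phi F) v s w))) => H.
  by exists (flip F e), w, t.
have [||| F'' [p [t' [ut' E' pos' lt']]]] := IH (flip F e) w (- t).
- exact: leq_trans lt len.
- by move: ut; rewrite /is_unit_step; lia.
- by rewrite E {1}/shift eqxx; move: ut H; rewrite /is_unit_step; lia.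
have EE : shift (Phi (flip F e)) w (- t) =1 shift (Phi F) v s.
  by move=> u; rewrite {1}/shift E /shift; case: (u == w) => //; lia.
exists F'', p, t'; split=> //; last exact: ltn_trans lt' lt.
- by move=> u; have := EE u; rewrite E' /shift => ->.
- by rewrite -EE.
Qed.


(** * Costs, and exchanges between optimal edge sets *)

(* The distance of [x] to the set of odd integers at most [m], together with
   [m] itself. *)
Definition parity_dist (m : nat) (x : int) : int :=
  if m%:Z <= x then x - m%:Z else (~~ odd `|x|%N)%:Z.

(* On [T] the cost is linearised, and may be negative. *)
Definition cost T v (x : int) : int :=
  if v \in T then x - (f v)%:Z else parity_dist (f v) x.

Definition total_cost T (x : vertex G -> int) : int := \sum_v cost T v (x v).

Definition cost_at T F v : int := cost T v (Phi F v).

Definition cost_optimal T F : Prop :=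
  forall F', total_cost T (Phi F) <= total_cost T (Phi F').

Definition one_step (x y x' : int) : Prop :=
  (x' = x + 1 /\ x < y) \/ (x' = x - 1 /\ y < x).

Lemma cost_out T v x : v \notin T -> cost T v x = parity_dist (f v) x.
Proof. by rewrite /cost => /negbTE ->. Qed.

Lemma cost_ge0 T v x : v \notin T -> 0 <= cost T v x.
Proof. by move=> vT; rewrite cost_out // /parity_dist; case: ifP; lia. Qed.

Lemma cost_step T v x s : is_unit_step s ->
  cost T v x - 1 <= cost T v (x + s) <= cost T v x + 1.
Proof.
rewrite /cost /parity_dist /is_unit_step.
by case: ifP => _; [| case: ifP; case: ifP]; lia.
Qed.

(** Off [T], a positive cost occurs above [f v], where all cheaper values lie to the left, or at an
    even value below [f v], both of whose neighbors cost 0. *)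
Lemma cost_decrease T v x y s : is_unit_step s -> 0 < s * (y - x) ->
  cost T v y < cost T v x -> cost T v (x + s) = cost T v x - 1.
Proof.
rewrite /cost /parity_dist /is_unit_step.
by case: ifP => _; [| case: ifP; case: ifP; case: ifP]; lia.
Qed.

Lemma total_cost_shift T x p s : total_cost T (shift x p s) =
  total_cost T x + (cost T p (x p + s) - cost T p (x p)).
Proof.
rewrite /total_cost (bigD1 p) //= [in RHS](bigD1 p) //= {1}/shift eqxx.
rewrite (eq_bigr (fun v => cost T v (x v))) => [|v /negbTE vp]; last first.
  by rewrite /shift vp.
by move: (\sum_(_ | _) _) => r; lia.
Qed.

Lemma eq_total_cost T x y : x =1 y -> total_cost T x = total_cost T y.
Proof. by move=> E; apply: eq_bigr => v _; rewrite E. Qed.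

Lemma exists_cost_optimal T : exists F, cost_optimal T F.
Proof.
case: (@Order.TotalTheory.arg_minP _ _ _ set0 xpredT
         (fun F => total_cost T (Phi F)) isT) => F _ H.
by exists F => F'; apply: H.
Qed.

Lemma optimal_total T F F' : cost_optimal T F -> cost_optimal T F' ->
  total_cost T (Phi F) = total_cost T (Phi F').
Proof. by move=> o o'; apply/eqP; rewrite eq_le o o'. Qed.

Lemma optimal_le T F F' : cost_optimal T F ->
  total_cost T (Phi F') <= total_cost T (Phi F) -> cost_optimal T F'.
Proof. by move=> o le F''; apply: le_trans le (o _). Qed.

Lemma total_cost_split T X F : total_cost T (Phi F) =
  \sum_(v in X) cost_at T F v + \sum_(v | v \notin X) cost_at T F v.
Proof. exact: bigID. Qed.

Lemma exists_cost_lt T X F F' :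
  total_cost T (Phi F) <= total_cost T (Phi F') ->
  \sum_(v in X) cost_at T F' v < \sum_(v in X) cost_at T F v ->
  exists2 z, z \notin X & cost_at T F z < cost_at T F' z.
Proof.
move=> le lt; apply: boolp.contrapT => nex; move: lt; apply/negP; rewrite -leNgt.
have : \sum_(v | v \notin X) cost_at T F' v <= \sum_(v | v \notin X) cost_at T F v.
  apply: ler_sum => v vX; rewrite leNgt; apply/negP => lt.
  by apply: nex; exists v.
by move: le; rewrite !(total_cost_split T X); lia.
Qed.

(** The step at [z] gains exactly 1 by [cost_decrease], and the step at [p] loses at most 1. *)
Lemma exchange_cost T F F' z : cost_at T F' z < cost_at T F z ->
  exists F'' s p t, [/\ is_unit_step s /\ is_unit_step t,
    0 < s * (Phi F' z - Phi F z) /\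
    0 < t * (Phi F' p - shift (Phi F) z s p),
    Phi F'' =1 shift (shift (Phi F) z s) p t,
    (gap F'' F' < gap F F')%N &
    total_cost T (Phi F'') <= total_cost T (Phi F)].
Proof.
move=> lt.
have [s us pos] : exists2 s, is_unit_step s & 0 < s * (Phi F' z - Phi F z).
  case: (ltgtP (Phi F' z) (Phi F z)) => H.
  - by exists (-1); [right | lia].
  - by exists 1; [left | lia].
  - by move: lt; rewrite /cost_at H ltxx.
have [F'' [p [t [ut E pos' lt']]]] := exchange us pos.
exists F'', s, p, t; split=> //.
rewrite (eq_total_cost _ E) !total_cost_shift (cost_decrease us pos lt).
by have := cost_step T p (shift (Phi F) z s p) ut; lia.
Qed.

(** Optimality forces the second step to lose exactly what the first one gained. The alternative at
    [z] covers two steps at the same vertex. *)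
Lemma exchange_optimal T F F' z : cost_optimal T F ->
  cost_at T F' z < cost_at T F z ->
  exists F'', [/\ cost_optimal T F'', (gap F'' F' < gap F F')%N,
    forall v, v != z -> Phi F'' v = Phi F v \/
      one_step (Phi F v) (Phi F' v) (Phi F'' v) /\
      cost_at T F'' v = cost_at T F v + 1 &
    one_step (Phi F z) (Phi F' z) (Phi F'' z) \/
      cost_at T F'' z = cost_at T F z].
Proof.
move=> o lt; have [F'' [s [p [t [[us ut] [pos pos'] E lt' le]]]]] := exchange_cost lt.
have o'' := optimal_le o le; exists F''; split=> //.
  move=> v /negbTE vz; rewrite E /shift vz; case: eqP => [vp | _]; last by left.
  right; split.
    by move: pos' ut; rewrite -vp /shift vz /is_unit_step /one_step; lia.
  have := o F''; rewrite (eq_total_cost _ E) !total_cost_shift.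
  rewrite (cost_decrease us pos lt) -vp /shift vz /cost_at E /shift vz -vp eqxx.
  by have := cost_step T v (Phi F v) ut; lia.
have := o F''; rewrite (eq_total_cost _ E) !total_cost_shift.
rewrite (cost_decrease us pos lt) /cost_at E /shift eqxx.
case: (eqVneq z p) => [<- | _ _]; last first.
  by left; move: us pos; rewrite /is_unit_step /one_step; lia.
have := cost_step T z (Phi F z + s) ut; rewrite !(cost_decrease us pos lt).
by right; lia.
Qed.

(** The totals agree, so some vertex other than [v] is cheaper in [F']. Exchanges at such vertices
    bring [F] closer to [F'] until one of them hits [v], which then costs 1 more. *)
Lemma optimal_raise T v F F' : cost_optimal T F -> cost_optimal T F' ->
  cost_at T F v < cost_at T F' v ->
  exists F'', [/\ cost_optimal T F'',
    one_step (Phi F v) (Phi F' v) (Phi F'' v) &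
    cost_at T F'' v = cost_at T F v + 1].
Proof.
have [n] := ubnP (gap F F'); elim: n F => // n IH F /ltnSE len o o' lt.
have [||z] := @exists_cost_lt T [set v] F' F.
- by rewrite (optimal_total o o').
- by rewrite !big_set1.
rewrite inE => zv lt'.
have [F'' [o'' ltg H _]] := exchange_optimal o lt'.
have [|E|[st E]] := H v; first by rewrite eq_sym.
  have [|F3 [o3 st E3]] := IH F'' (leq_trans ltg len) o'' o'.
    by rewrite /cost_at E.
  by exists F3; split=> //; move: st E3; rewrite /cost_at E.
by exists F''.
Qed.

(** * Degrees at deficient vertices *)

Definition strictly_below_even F v : bool :=
  (Phi F v < (f v)%:Z) && ~~ odd `|Phi F v|%N.

(* The part [D] of the Gallai-Edmonds decomposition. *)
Definition deficient T v : Prop :=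
  v \notin T /\ exists2 F, cost_optimal T F & strictly_below_even F v.

Lemma cost_below_even T F v : v \notin T -> strictly_below_even F v ->
  cost_at T F v = 1.
Proof.
move=> vT; rewrite /strictly_below_even /cost_at cost_out // /parity_dist.
by case: ifP; lia.
Qed.

(** An odd degree below [f v] costs 0 and the surplus in [F] does not, so [optimal_raise] yields an
    even degree still below [f v]. *)
Lemma deficient_of_both_sides T v F F' : v \notin T ->
  cost_optimal T F -> (f v)%:Z < Phi F v ->
  cost_optimal T F' -> Phi F' v < (f v)%:Z -> deficient T v.
Proof.
move=> vT o gt o' lt; split=> //.
case: (boolP (strictly_below_even F' v)) => [H | nH]; first by exists F'.
have [|F'' [o'' st E]] := @optimal_raise T v F' F o' o.
  move: nH; rewrite /strictly_below_even /cost_at !cost_out // /parity_dist.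
  by case: ifP; case: ifP; lia.
exists F'' => //; move: st E nH; rewrite /strictly_below_even /one_step.
rewrite /cost_at !cost_out // /parity_dist.
by case: ifP; case: ifP; lia.
Qed.

(** Otherwise [optimal_raise] would reach cost 2 in one step from a degree below [f v], but that
    step ends at [f v] at most. *)
Lemma deficient_cost_le1 T v F : deficient T v -> cost_optimal T F ->
  cost_at T F v <= 1.
Proof.
case=> vT [F' o' H] o; rewrite leNgt; apply/negP => gt.
have [|F'' [_ st E]] := @optimal_raise T v F' F o' o.
  by rewrite cost_below_even.
move: E; rewrite (cost_below_even vT H); move: st H gt.
rewrite /strictly_below_even /one_step /cost_at !cost_out // /parity_dist.
by case: ifP; case: ifP; lia.
Qed.

Lemma deficient_even_lt T v F : deficient T v -> ~~ odd (f v) ->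
  cost_optimal T F -> Phi F v < (f v)%:Z.
Proof.
move=> dv ev o; have [vT [F' o' H]] := dv.
(* From degree [f v], a raise toward [F'] would land on the odd value [f v - 1], which costs 0. *)
have neq F0 : cost_optimal T F0 -> Phi F0 v <> (f v)%:Z.
  move=> o0 E; have [|F'' [_ st E'']] := @optimal_raise T v F0 F' o0 o'.
    rewrite (cost_below_even vT H) /cost_at cost_out // /parity_dist E.
    by case: ifP; lia.
  move: st E''; rewrite /one_step /cost_at !cost_out // /parity_dist E.
  by move: H; rewrite /strictly_below_even; case: ifP; case: ifP; lia.
rewrite ltNge; apply/negP => ge.
have E1 : Phi F v = (f v)%:Z + 1.
  have := deficient_cost_le1 dv o; have := neq _ o; move: ge.
  by rewrite /cost_at cost_out // /parity_dist; case: ifP; lia.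
(* A step down from [f v + 1] reaches the excluded value [f v] or, if both steps fall on [v], the
   value [f v - 1] at a smaller total cost. *)
have [||F'' [p [t [ut E pos _]]]] := @exchange F F' v (-1).
- by right.
- by move: H; rewrite /strictly_below_even; lia.
have tot := eq_total_cost T E; rewrite !total_cost_shift in tot.
have cv : cost T v (Phi F v + -1) - cost T v (Phi F v) = -1.
  by rewrite E1 !cost_out // /parity_dist; case: ifP; case: ifP; lia.
have /neq : cost_optimal T F''.
  apply: (optimal_le o); have := cost_step T p (shift (Phi F) v (-1) p) ut.
  by lia.
apply; rewrite E /shift eqxx; case: (eqVneq v p) => [vp | _]; last by lia.
have := o F''; move: tot pos; rewrite -vp /shift eqxx cv E1.
rewrite !cost_out // /parity_dist; move: ut H.
by rewrite /is_unit_step /strictly_below_even; case: ifP; case: ifP; lia.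
Qed.

(** The form of the cost that [component_parity] requires. For odd [f v] the only possible degree
    above [f v] is [f v + 1], which is even and costs 1. *)
Lemma deficient_cost T v F : deficient T v -> cost_optimal T F ->
  cost_at T F v = (~~ odd `|Phi F v|%N)%:Z.
Proof.
move=> dv o; have := deficient_cost_le1 dv o; have := deficient_even_lt dv _ o.
have [vT _] := dv; rewrite /cost_at cost_out // /parity_dist.
case: (boolP (odd (f v))) => oddf => [_ | /(_ isT)]; case: ifP; lia.
Qed.

(** * Gallai's lemma *)

Lemma flip_end F e i : endpt e i != endpt e (~~ i) ->
  Phi (flip F e) (endpt e i) = Phi F (endpt e i) + flip_sign F e i.
Proof.
by move=> /negbTE ne; rewrite (colored_degree_flip F e i) /shift ne eqxx.
Qed.

Lemma flip_other F e i v : v != endpt e i -> v != endpt e (~~ i) ->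
  Phi (flip F e) v = Phi F v.
Proof.
move=> /negbTE n1 /negbTE n2.
by rewrite (colored_degree_flip F e i) /shift n1 n2.
Qed.

(** As [flip F e] cannot beat [F], the gain of 1 at one end is paid in full at the other. *)
Lemma flip_optimal T F e i : endpt e i != endpt e (~~ i) -> cost_optimal T F ->
  cost T (endpt e i) (Phi F (endpt e i) + flip_sign F e i)
    = cost_at T F (endpt e i) - 1 ->
  cost_optimal T (flip F e) /\
  cost_at T (flip F e) (endpt e (~~ i)) = cost_at T F (endpt e (~~ i)) + 1.
Proof.
move=> ne o dec.
have E := colored_degree_flip F e i; have tot := eq_total_cost T E.
rewrite !total_cost_shift dec in tot.
have ne' : endpt e (~~ i) != endpt e i by rewrite eq_sym.
have := flip_end F (i := ~~ i); rewrite negbK => /(_ e ne') Ew.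
have st := cost_step T (endpt e (~~ i)) (Phi F (endpt e (~~ i)))
             (flip_sign_unit F e (~~ i)).
move: tot; rewrite /cost_at {1 2}/shift (negbTE ne') Ew => tot.
have le : total_cost T (Phi (flip F e)) <= total_cost T (Phi F).
  by move: st tot; rewrite /cost_at; lia.
split; first exact: optimal_le o le.
by have := o (flip F e); move: st tot; rewrite /cost_at; lia.
Qed.

(** Counterpart of the statement that no maximum matching misses both [u] and [v]. *)
Definition exclusive T u v : Prop :=
  forall F, cost_optimal T F -> cost_at T F u + cost_at T F v <= 1.

(** Both neighbors of an even value below [f] cost 0, so a flip of either sign gains 1 there. *)
Lemma flip_below_even T F e i :
  endpt e i != endpt e (~~ i) -> endpt e i \notin T ->
  cost_optimal T F -> strictly_below_even F (endpt e i) ->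
  cost_optimal T (flip F e) /\
  cost_at T (flip F e) (endpt e (~~ i)) = cost_at T F (endpt e (~~ i)) + 1.
Proof.
move=> ne uT o below; apply: flip_optimal => //.
rewrite (cost_below_even uT below) cost_out // /parity_dist.
move: below (flip_sign_unit F e i); rewrite /strictly_below_even /is_unit_step.
by case: ifP; lia.
Qed.

(** Suppose [F] charges both ends, and let [F1] have [u] strictly below even. Flipping [e] in [F1]
    charges [v], so [v] is free in [F1]. Hence [F] is cheaper than [F1] somewhere else; exchanging
    there leaves [u] alone, whose cost cannot exceed 1, and closes the gap forever. *)
Lemma exclusive_adjacent T e i : endpt e i != endpt e (~~ i) ->
  deficient T (endpt e i) -> deficient T (endpt e (~~ i)) ->
  exclusive T (endpt e i) (endpt e (~~ i)).
Proof.
move=> ne; have uv : endpt e i \notin [set endpt e (~~ i)] by rewrite inE.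
set u := endpt e i in ne uv *; set v := endpt e (~~ i) in ne uv *.
move=> du dv F o; rewrite leNgt; apply/negP => gt.
have [uT [F1 o1 b1]] := du; have [vT _] := dv.
have le_u := deficient_cost_le1 du; have le_v := deficient_cost_le1 dv.
have [n] := ubnP (gap F1 F); elim: n F1 o1 b1 => // n IH F1 o1 b1 /ltnSE len.
have [o1' E1] := flip_below_even ne uT o1 b1.
have := le_v _ o1'; rewrite -/v E1 => v0.
have [||z] := @exists_cost_lt T (u |: [set v]) F F1.
- by rewrite (optimal_total o o1).
- rewrite !big_setU1 //= !big_set1 (cost_below_even uT b1).
  by move: v0 gt; rewrite -/v; lia.
rewrite !inE negb_or => /andP [zu _] lt.
have [F2 [o2 ltg H _]] := exchange_optimal o1 lt.
have [|Eu|[_ Eu]] := H u; first by rewrite eq_sym.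
- apply: (IH F2) => //; last exact: leq_trans ltg len.
  by move: b1; rewrite /strictly_below_even Eu.
- by have := le_u _ o2; rewrite Eu (cost_below_even uT b1).
Qed.

(** If [F] charges [u] and [v], a set [F'] charging [w] is free at both, hence dearer than [F] off
    the three vertices. Exchanging there keeps [w] charged and closes the gap forever. *)
Lemma exclusive_trans T u w v : u != w -> u != v -> v != w ->
  deficient T u -> deficient T w -> deficient T v ->
  exclusive T u w -> exclusive T w v -> exclusive T u v.
Proof.
move=> uw uv vw du dw dv xuw xwv F o; rewrite leNgt; apply/negP => gt.
have le_u := deficient_cost_le1 du o; have le_v := deficient_cost_le1 dv o.
have [uT _] := du; have [vT _] := dv; have [wT [F' o' b']] := dw.
have {b'} := cost_below_even wT b'.
have [n] := ubnP (gap F' F); elim: n F' o' => // n IH F' o' /ltnSE len c'.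
have [||z] := @exists_cost_lt T (u |: (v |: [set w])) F F'.
- by rewrite (optimal_total o o').
- rewrite !big_setU1 ?inE ?negb_or ?uv //= !big_set1 c'.
  have := xuw _ o'; have := xwv _ o'; have := cost_ge0 (Phi F w) wT.
  by move: gt; rewrite c' /cost_at; lia.
rewrite !inE !negb_or => /and3P [_ _ zw] lt.
have [F2 [o2 ltg H _]] := exchange_optimal o' lt.
have [|Ew|[_ Ew]] := H w; first by rewrite eq_sym.
- apply: (IH F2) => //; first exact: leq_trans ltg len.
  by rewrite -c' /cost_at Ew.
- by have := deficient_cost_le1 dw o2; rewrite Ew c'.
Qed.

(** * Components in the absence of surplus *)

(* The part [A] of the Gallai-Edmonds decomposition is empty. *)
Definition no_surplus T : Prop := forall v F,
  v \notin T -> cost_optimal T F -> (f v)%:Z < Phi F v -> deficient T v.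

Lemma positive_cost_deficient T v F : no_surplus T -> v \notin T ->
  cost_optimal T F -> 0 < cost_at T F v -> deficient T v.
Proof.
move=> noA vT o; rewrite /cost_at cost_out // /parity_dist.
case: ifP => [_ gt | lt even]; first by apply: (noA v F) => //; lia.
by split=> //; exists F => //; rewrite /strictly_below_even; lia.
Qed.

(** Flipping the edge carries the cost 1 from [u] over to [v]. *)
Lemma deficient_adjacent T u v : no_surplus T -> deficient T u ->
  adjacent_minus T u v -> deficient T v /\ (u != v -> exclusive T u v).
Proof.
move=> noA du; have [uT [F o b]] := du.
case/and3P => _ vT /existsP [e /existsP [i /andP [/eqP eu /eqP ev]]].
case: (eqVneq u v) => [<- // | ne]; subst u v.
have dv : deficient T (endpt e (~~ i)).
  have [o' E] := flip_below_even ne uT o b.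
  apply: (positive_cost_deficient noA vT o'); rewrite E.
  by have := cost_ge0 (Phi F (endpt e (~~ i))) vT; rewrite /cost_at; lia.
by split=> // _; apply: exclusive_adjacent.
Qed.

Lemma deficient_connect T u v : no_surplus T -> deficient T u ->
  connect (adjacent_minus T) u v ->
  deficient T v /\ (u != v -> exclusive T u v).
Proof.
move=> noA du /connectP [q]; elim: q u du => [|w q IH] u du /= => [_ -> | ].
  by split=> //; rewrite eqxx.
case/andP => /(deficient_adjacent noA du) [dw xuw] qw ev.
have [dv xwv] := IH w dw qw ev; split=> // uv.
case: (eqVneq u w) => [E | uw]; first by rewrite E; apply: xwv; rewrite -E.
case: (eqVneq w v) => [<- | wv]; first exact: xuw.
apply: (@exclusive_trans T u w v) => //; first by rewrite eq_sym.
- exact: xuw.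
- exact: xwv.
Qed.

Lemma exclusive_sum_le1 T X F : cost_optimal T F ->
  {in X, forall v, deficient T v} ->
  {in X &, forall u v, u != v -> exclusive T u v} ->
  \sum_(v in X) cost_at T F v <= 1.
Proof.
move=> o dX xX.
have ge0 v : v \in X -> 0 <= cost_at T F v.
  by move=> /dX [vT _]; apply: cost_ge0.
case: (boolP [exists v in X, 0 < cost_at T F v]) => [/existsP [u /andP [uX pos]] | ].
  rewrite (bigD1 u) //= big1 => [|v /andP [vX vu]].
    by rewrite addr0; apply: deficient_cost_le1 (dX u uX) o.
  have := xX u v uX vX; rewrite eq_sym vu => /(_ isT _ o).
  by have := ge0 v vX; lia.
rewrite negb_exists => /forallP none; rewrite big1 // => v vX.
by have := none v; rewrite vX /= -leNgt; have := ge0 v vX; lia.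
Qed.

(** * Linearisation at a surplus vertex *)

(* Linearising the cost at a vertex [a] in the part [A] cannot lower the
   minimum: the cost has slope one to the left of [f a] as well. *)
Lemma linearise_cost T a F : a \notin T -> ~ deficient T a ->
  cost_optimal T F -> (f a)%:Z < Phi F a ->
  forall F', total_cost T (Phi F) <= total_cost (a |: T) (Phi F').
Proof.
move=> aT nda.
have ge F0 F1 : cost_optimal T F0 -> (f a)%:Z < Phi F0 a ->
    cost_optimal T F1 -> (f a)%:Z <= Phi F1 a.
  move=> o0 gt o1; rewrite leNgt; apply/negP => lt; apply: nda.
  exact: deficient_of_both_sides o0 gt o1 lt.
have cost_neq z x : z != a -> cost (a |: T) z x = cost T z x.
  by move=> /negbTE za; rewrite /cost !inE za.
have cost_a x : cost (a |: T) a x = x - (f a)%:Z by rewrite /cost !inE eqxx.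
have tot F0 : total_cost (a |: T) (Phi F0) =
    total_cost T (Phi F0) - cost_at T F0 a + (Phi F0 a - (f a)%:Z).
  rewrite !(total_cost_split _ [set a]) !big_set1 {1}/cost_at cost_a.
  rewrite (eq_bigr (fun v => cost_at T F0 v)) => [|v]; last first.
    by rewrite inE /cost_at => /cost_neq ->.
  by move: (\sum_(_ | _) _) => r; lia.
(* Take a counterexample pair with smallest gap; the facts below force [F'] to be optimal as well,
   against [ge]. *)
move=> o gt F'; have [n] := ubnP (gap F F'); elim: n F F' o gt => // n IH F F' o gt.
move=> /ltnSE len; rewrite leNgt; apply/negP => lt.
have lt_a : Phi F' a < (f a)%:Z.
  rewrite ltNge; apply/negP => ge_a; have := o F'; move: lt; rewrite tot.
  by rewrite /cost_at cost_out // /parity_dist ge_a; lia.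
have le1 : cost_at T F' a <= 1.
  by rewrite /cost_at cost_out // /parity_dist; case: ifP; lia.
have ca : cost_at T F a = Phi F a - (f a)%:Z.
  by rewrite /cost_at cost_out // /parity_dist ltW.
(* An exchange at [z] gives a closer pair: if it moved [a], it would do so downward, lowering the
   cost instead of raising it. *)
have le_F z : z != a -> cost_at T F z <= cost_at T F' z.
  move=> za; rewrite leNgt; apply/negP => ltz.
  have [F2 [o2 ltg H _]] := exchange_optimal o ltz.
  have [|Ea|[st Ea]] := H a; first by rewrite eq_sym.
  - have := IH F2 F' o2; rewrite Ea (optimal_total o2 o) => /(_ gt).
    by move=> /(_ (leq_trans ltg len)); rewrite leNgt lt.
  - move: st Ea; rewrite ca /one_step /cost_at cost_out // /parity_dist.
    by case: ifP; lia.
(* From a larger surplus, an exchange at [a] itself would leave a surplus and a closer pair. *)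
have E1 : Phi F a = (f a)%:Z + 1.
  apply: boolp.contrapT => ne.
  have [|F2 [o2 ltg _ H]] := @exchange_optimal T F F' a o; first by lia.
  have gt2 : (f a)%:Z < Phi F2 a.
    have := ge _ _ o gt o2; move: H; rewrite ca /one_step /cost_at.
    by rewrite cost_out // /parity_dist; case: ifP; lia.
  have := IH F2 F' o2 gt2 (leq_trans ltg len).
  by rewrite (optimal_total o2 o) leNgt lt.
(* Here [F'] is moved toward [F], under the linearised cost, again giving a closer
   counterexample. *)
have eq_F z : z != a -> cost_at T F z = cost_at T F' z.
  move=> za; apply/eqP; rewrite eq_le le_F //= leNgt; apply/negP => ltz.
  have [|F2 [s [p [t [_ _ _ ltg le]]]]] := @exchange_cost (a |: T) F' F z.
    by rewrite /cost_at !cost_neq.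
  have := IH F F2 o gt; rewrite gapC => /(_ _) H.
  have {}H : total_cost T (Phi F) <= total_cost (a |: T) (Phi F2).
    by apply: H; apply: leq_trans ltg _; rewrite gapC.
  by have := le_lt_trans le lt; rewrite ltNge H.
(* The two totals differ only at [a], where [F] costs 1 and [F'] at most 1. *)
have E : total_cost T (Phi F') = total_cost T (Phi F) - cost_at T F a + cost_at T F' a.
  rewrite !(total_cost_split T [set a]) !big_set1.
  rewrite (eq_bigr (fun v => cost_at T F v)) => [|v]; last first.
    by rewrite inE => /eq_F.
  by move: (\sum_(_ | _) _) => r; lia.
have o' : cost_optimal T F' by apply: (optimal_le o); lia.
by have := ge _ _ o gt o'; lia.
Qed.

(** * Parity counts over components *)

(** The colored analog of the number of edges between [X] and [Y], with colors read on the [X] side;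
    an edge inside both sets counts at each end. *)
Definition signed_ends F X Y : int := \sum_(e in F) \sum_i
  ((endpt e i \in X) && (endpt e (~~ i) \in Y))%:Z * color_sign (c e i).

Lemma sum_colored_degree F X :
  \sum_(v in X) Phi F v = signed_ends F X [set: vertex G].
Proof.
rewrite /colored_degree exchange_big /=; apply: eq_bigr => e _.
rewrite big_bool /= !inE !andbT.
transitivity (\sum_(v in X) ((endpt e true == v)%:Z * color_sign (c e true)
    + (endpt e false == v)%:Z * color_sign (c e false))).
  by apply: eq_bigr => v _; rewrite (end_valueE e v true).
have H i : \sum_(v in X) (endpt e i == v)%:Z * color_sign (c e i)
           = (endpt e i \in X)%:Z * color_sign (c e i).
  case: (boolP (endpt e i \in X)) => uX.
    rewrite (bigD1 (endpt e i)) //= eqxx big1 ?addr0 // => v /andP [_ /negbTE].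
    by rewrite eq_sym => ->; rewrite mul0r.
  rewrite mul0r big1 // => v vX; case: eqP => [E | _]; last by rewrite mul0r.
  by rewrite E vX in uX.
by rewrite big_split /= !H.
Qed.

Lemma adjacent_minus_sym T : symmetric (adjacent_minus T).
Proof.
have imp u v : adjacent_minus T u v -> adjacent_minus T v u.
  case/and3P => uT vT /existsP [e /existsP [i /andP [eu ev]]].
  apply/and3P; split=> //; apply/existsP; exists e; apply/existsP.
  by exists (~~ i); rewrite negbK ev eu.
by move=> u v; apply/idP/idP; apply: imp.
Qed.

Lemma adjacent_minus_equiv T :
  {in ~: T & &, equivalence_rel (connect (adjacent_minus T))}.
Proof.
move=> x y z _ _ _; split=> // xy; apply: same_connect => //.
by apply: sym_connect_sym; apply: adjacent_minus_sym.
Qed.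

Lemma components_partition T : partition (components_minus T) (~: T).
Proof. exact: equivalence_partitionP (@adjacent_minus_equiv T). Qed.

Lemma in_component T K u v :
  K \in components_minus T -> u \in K ->
  (v \in K) = (v \notin T) && connect (adjacent_minus T) u v.
Proof.
case/imsetP => x _ -> ; rewrite !inE => /andP [_ xu]; congr (_ && _).
by apply: same_connect => //; apply: sym_connect_sym; apply: adjacent_minus_sym.
Qed.

Lemma component_sub T K v :
  K \in components_minus T -> v \in K -> v \notin T.
Proof. by move=> KP vK; have := vK; rewrite (in_component v KP vK) => /andP []. Qed.

Lemma component_edge T K e i : K \in components_minus T ->
  endpt e i \in K -> endpt e (~~ i) \notin T -> endpt e (~~ i) \in K.
Proof.
move=> KP uK vT; rewrite (in_component _ KP uK) vT; apply: connect1.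
apply/and3P; split=> //; first exact: component_sub uK.
by apply/existsP; exists e; apply/existsP; exists i; rewrite !eqxx.
Qed.

Lemma sum_components T (g : vertex G -> int) : \sum_(v | v \notin T) g v =
  \sum_(K in components_minus T) \sum_(v in K) g v.
Proof.
have /and3P [/eqP cov triv _] := components_partition T.
rewrite -(big_trivIset _ triv) /= cov; apply: eq_bigl => v.
by rewrite inE.
Qed.

Lemma signed_ends_components F T : signed_ends F T [set: vertex G] =
  signed_ends F T T + \sum_(K in components_minus T) signed_ends F T K.
Proof.
rewrite /signed_ends [Y in _ + Y]exchange_big -big_split /=.
apply: eq_bigr => e _; rewrite [Y in _ + Y]exchange_big -big_split /=; apply: eq_bigr => i _.
rewrite -mulr_suml -mulrDl; congr (_ * _); rewrite inE andbT.
set w := endpt e (~~ i); case: (endpt e i \in T) => /=; last first.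
  by rewrite big1 ?addr0.
transitivity ((w \in T)%:Z + (w \notin T)%:Z); first by case: (w \in T).
congr (_ + _); transitivity (\sum_(v | v \notin T) (v == w)%:Z).
  case: (boolP (w \in T)) => wT /=.
    by rewrite big1 // => v; case: eqP => // ->; rewrite wT.
  rewrite (bigD1 w) //= eqxx big1 ?addr0 // => v /andP [_ /negbTE ->].
  by [].
rewrite sum_components; apply: eq_bigr => K _.
case: (boolP (w \in K)) => wK.
  rewrite (bigD1 w) //= eqxx big1 ?addr0 // => v /andP [_ /negbTE ->].
  by [].
by rewrite big1 // => v; case: eqP => // ->; rewrite (negbTE wK).
Qed.

Lemma odd_components_sum T :
  (odd_components T)%:Z = \sum_(K in components_minus T) (odd #|K|)%:Z.
Proof.
rewrite /odd_components -sum1_card -natz natr_sum /= big_mkcond /=.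
rewrite [RHS]big_mkcond /=; apply: eq_bigr => K _; rewrite inE.
by case: (K \in _); case: (odd _).
Qed.

(** An edge meeting [K] lies inside [K] or leads to [T]; either way it contributes two signs, an
    even number. *)
Lemma component_degree_parity T F K :
  K \in components_minus T ->
  (2 %| \sum_(v in K) Phi F v + signed_ends F T K)%Z.
Proof.
move=> KP; rewrite sum_colored_degree /signed_ends -big_split /=.
apply: rpred_sum => e _; rewrite !big_bool /= !inE !andbT.
have H i := @component_edge T K e i KP.
have D i := @component_sub T K (endpt e i) KP.
move: (H true) (H false) (D true) (D false) => /=.
move: (color_sign_unit (c e true)) (color_sign_unit (c e false)).
rewrite /is_unit_step.
move: (color_sign _) (color_sign _) => s s'.
case: (endpt e true \in K); case: (endpt e false \in K);
  case: (endpt e true \in T); case: (endpt e false \in T) => /=; lia.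
Qed.

(** Degree plus cost is odd at every vertex of [K]. *)
Lemma component_parity T F K : K \in components_minus T ->
  {in K, forall v, cost_at T F v = (~~ odd `|Phi F v|%N)%:Z} ->
  (2 %| signed_ends F T K + \sum_(v in K) cost_at T F v - #|K|%:Z)%Z.
Proof.
move=> KP H; have := component_degree_parity F KP.
have par (x : int) : (2 %| x + (~~ odd `|x|%N)%:Z - 1)%Z by lia.
have : (2 %| \sum_(v in K) (Phi F v + cost_at T F v - 1))%Z.
  by apply: rpred_sum => v vK; rewrite H //; apply: par.
rewrite sumrB big_split /= sumr_const.
have -> : 1 *+ #|K| = #|K|%:Z :> int by rewrite natz.
move: (\sum_(_ in _) _) (\sum_(_ in _) _) => x y; lia.
Qed.

(** * The upper bound by odd components *)

Lemma flip_red_end T F e i : cost_optimal T F -> e \in F -> c e i = Red ->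
  endpt e i \in T -> endpt e (~~ i) \notin T ->
  cost_optimal T (flip F e) /\
  cost_at T (flip F e) (endpt e (~~ i)) = cost_at T F (endpt e (~~ i)) + 1.
Proof.
move=> o eF red aT wT; apply: flip_optimal => //.
  by apply: contraNneq wT => <-.
by rewrite /cost_at /cost aT /flip_sign eF red /=; lia.
Qed.

(** Deleting an edge with two red ends in [T] would lower the linear cost by 2. *)
Lemma signed_ends_inner_le0 T F : cost_optimal T F -> signed_ends F T T <= 0.
Proof.
move=> o; apply: sumr_le0 => e eF; rewrite big_bool /=.
case: (boolP (endpt e true \in T)) => aT; last by rewrite andbF !mul0r.
case: (boolP (endpt e false \in T)) => bT; last by rewrite !mul0r.
rewrite /= !mul1r.
case ca: (c e true); case cb: (c e false) => //.
have := o (flip F e); rewrite (eq_total_cost _ (colored_degree_flip F e true)).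
rewrite !total_cost_shift /cost aT /= bT /flip_sign eF ca cb /=.
by lia.
Qed.

Lemma signed_ends_no_red F X Y :
  (forall e i, e \in F -> endpt e i \in X -> endpt e (~~ i) \in Y ->
     c e i <> Red) ->
  signed_ends F X Y <= 0.
Proof.
move=> H; apply: sumr_le0 => e eF; apply: sumr_le0 => i _.
case: (boolP (_ && _)) => [/andP [aX bY] | _]; last by rewrite mul0r.
by have := H e i eF aX bY; case: (c e i).
Qed.

Lemma component_cost_le1 T F K u : no_surplus T ->
  cost_optimal T F -> K \in components_minus T -> u \in K -> deficient T u ->
  \sum_(v in K) cost_at T F v <= 1.
Proof.
move=> noA o KP uK du.
have conn x y : x \in K -> y \in K -> connect (adjacent_minus T) x y.
  by move=> xK; rewrite (in_component _ KP xK) => /andP [].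
have dK v : v \in K -> deficient T v.
  by move=> vK; case: (deficient_connect noA du (conn _ _ uK vK)).
apply: exclusive_sum_le1 => // x y xK yK xy.
by case: (deficient_connect noA (dK x xK) (conn _ _ xK yK)) => _; apply.
Qed.

Lemma deficient_component_bound T F K u : no_surplus T ->
  cost_optimal T F -> K \in components_minus T -> u \in K -> deficient T u ->
  signed_ends F T K + \sum_(v in K) cost_at T F v <= (odd #|K|)%:Z.
Proof.
move=> noA o KP uK du.
have le1 F0 : cost_optimal T F0 -> \sum_(v in K) cost_at T F0 v <= 1.
  by move=> o0; apply: component_cost_le1 uK du.
have ge0 F0 v : v \in K -> 0 <= cost_at T F0 v.
  by move=> vK; apply: cost_ge0; apply: component_sub vK.
have dK v : v \in K -> deficient T v.
  rewrite (in_component _ KP uK) => /andP [_ cuv].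
  by case: (deficient_connect noA du cuv).
(* If [K] already costs 1, deleting an edge that is red at its end in [T] would raise the cost of
   [K] to 2. *)
have ends_le0 F0 : cost_optimal T F0 -> 1 <= \sum_(v in K) cost_at T F0 v ->
    signed_ends F0 T K <= 0.
  move=> o0 ge1; apply: signed_ends_no_red => e i eF aT wK red.
  have wT := component_sub KP wK.
  have [o1 E1] := flip_red_end o0 eF red aT wT.
  have := le1 _ o1; rewrite (bigD1 (endpt e (~~ i))) //= E1.
  rewrite (eq_bigr (fun v => cost_at T F0 v)) => [|v /andP [vK vw]]; last first.
    rewrite /cost_at (@flip_other F0 e i) //.
    by apply: contraTneq vK => ->; apply/negP => /(component_sub KP); rewrite aT.
  move: ge1; rewrite (bigD1 (endpt e (~~ i))) //=.
  by move: (\sum_(_ in _ | _) _) => r; lia.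
(* By [component_parity] the left side has the parity of [#|K|], so the bound 1 improves to 0 when
   [#|K|] is even. *)
suff : signed_ends F T K + \sum_(v in K) cost_at T F v <= 1.
  have := @component_parity T F K KP _.
  move=> /(_ (fun v vK => deficient_cost (dK v vK) o)).
  move: (\sum_(_ in _) _) => r; case: (boolP (odd #|K|)); lia.
have := le1 _ o; case: (leP 1 (\sum_(v in K) cost_at T F v)) => [ge1 | lt1] le.
  by have := ends_le0 _ o ge1; lia.
have sum_ge0 F0 (P : pred (vertex G)) :
    0 <= \sum_(v in K | P v) cost_at T F0 v.
  by apply: sumr_ge0 => v /andP [vK _]; apply: ge0.
(* Now [K] costs 0. Deleting one red edge charges [K], so by [ends_le0] the remaining ends sum to at
   most 0 and the original ones to at most 1. *)
suff : signed_ends F T K <= 1 by lia.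
rewrite leNgt; apply/negP => gt1.
have : signed_ends F T K <= 0; last by lia.
apply: signed_ends_no_red => e i eF aT wK red.
have wT := component_sub KP wK.
have [o1 E1] := flip_red_end o eF red aT wT.
have : signed_ends (flip F e) T K <= 0.
  apply: ends_le0 => //; rewrite (bigD1 (endpt e (~~ i))) //= E1.
  have := ge0 F _ wK; have := sum_ge0 (flip F e) (fun v => v != endpt e (~~ i)).
  by move: (\sum_(_ in _ | _) _) => r; lia.
move: gt1; rewrite /flip eF /signed_ends (big_setD1 e eF) /=.
have -> : \sum_j ((endpt e j \in T) && (endpt e (~~ j) \in K))%:Z
            * color_sign (c e j) = 1.
  rewrite (bigD1 i) //= aT wK red big1 ?addr0 // => j ji.
  have -> : j = ~~ i by move: ji; case: (i); case: (j).
  by rewrite (negbTE wT) mul0r.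
by move: (\sum_(_ in _) _) => r; lia.
Qed.

Lemma satisfied_component_bound T F K : no_surplus T ->
  cost_optimal T F -> K \in components_minus T ->
  (forall u, u \in K -> ~ deficient T u) ->
  signed_ends F T K + \sum_(v in K) cost_at T F v <= 0.
Proof.
move=> noA o KP nd.
have le0 F0 v : cost_optimal T F0 -> v \in K -> cost_at T F0 v <= 0.
  move=> o0 vK; rewrite leNgt; apply/negP => pos; apply: (nd v) => //.
  exact: positive_cost_deficient noA (component_sub KP vK) o0 pos.
have H1 : \sum_(v in K) cost_at T F v <= 0 by apply: sumr_le0 => v; apply: le0.
have H2 : signed_ends F T K <= 0; last by lia.
apply: signed_ends_no_red => e i eF aT wK red.
have wT := component_sub KP wK.
have [o1 E1] := flip_red_end o eF red aT wT.
have := le0 _ _ o1 wK; rewrite E1.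
by have := cost_ge0 (Phi F (endpt e (~~ i))) wT; rewrite /cost_at; lia.
Qed.

Lemma sum_cost_in T F X : X \subset T -> \sum_(v in X) cost_at T F v =
  signed_ends F X [set: vertex G] - (\sum_(v in X) f v)%N%:Z.
Proof.
move=> /subsetP XT; rewrite -sum_colored_degree.
have -> : (\sum_(v in X) f v)%N%:Z = \sum_(v in X) (f v)%:Z.
  by rewrite -natz natr_sum; apply: eq_bigr => v _; rewrite natz.
by rewrite -sumrB; apply: eq_bigr => v /XT vT; rewrite /cost_at /cost vT.
Qed.

Lemma total_cost_le_odd_components T F : no_surplus T -> cost_optimal T F ->
  total_cost T (Phi F) <= (odd_components T)%:Z - (\sum_(v in T) f v)%N%:Z.
Proof.
move=> noA o; rewrite (total_cost_split T T) sum_cost_in // sum_components.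
rewrite signed_ends_components odd_components_sum.
have in_le0 := signed_ends_inner_le0 o.
have : \sum_(K in components_minus T) (signed_ends F T K
         + \sum_(v in K) cost_at T F v)
       <= \sum_(K in components_minus T) (odd #|K|)%:Z.
  apply: ler_sum => K KP.
  case: (boolp.pselect (exists2 u, u \in K & deficient T u)) => [[u uK du] | nd].
    exact: deficient_component_bound uK du.
  apply: le_trans (satisfied_component_bound noA o KP _) _ => // u uK du.
  by apply: nd; exists u.
rewrite big_split /=.
by move: (\sum_(_ in _) _) (\sum_(_ in _) _) (\sum_(_ in _) _) in_le0 => x y z; lia.
Qed.

(** * Costs versus distances, optimality and the set [Dset] *)

Lemma JstarP v h : Jstar f v h <-> parity_dist (f v) h = 0.
Proof.
rewrite /parity_dist; split.
  by move=> J; have {}J : (odd `|h|%N /\ h <= (f v)%:Z) \/ h = (f v)%:Z := J;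
    case: ifP; lia.
move=> E; suff : (odd `|h|%N /\ h <= (f v)%:Z) \/ h = (f v)%:Z by [].
by move: E; case: ifP; lia.
Qed.

Lemma dist_parity_dist F v : (dist c f F v)%:Z = parity_dist (f v) (Phi F v).
Proof.
rewrite /dist; case: ex_minnP => d /boolp.asboolP [h /JstarP Jh ->] H.
have [h0 /JstarP J0 E0] : exists2 h0, parity_dist (f v) h0 = 0 &
    `|Phi F v - h0|%N%:Z = parity_dist (f v) (Phi F v).
  rewrite /parity_dist; case: (leP (f v)%:Z (Phi F v)) => cmp.
    by exists (f v)%:Z; [rewrite lexx subrr | lia].
  by exists (Phi F v - (~~ odd `|Phi F v|%N)%:Z); [case: ifP | ]; lia.
have := H `|Phi F v - h0|%N; rewrite /dist_value => /(_ _) le.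
have {le} := le ltac:(by apply/boolp.asboolP; exists h0).
move: Jh E0; rewrite /parity_dist; case: ifP; case: ifP; lia.
Qed.

Lemma deficiency_total_cost F :
  (deficiency c f F)%:Z = total_cost set0 (Phi F).
Proof.
rewrite /deficiency -natz natr_sum; apply: eq_bigr => v _.
by rewrite natz dist_parity_dist cost_out ?inE.
Qed.

Lemma optimalP F : optimal c f F <-> cost_optimal set0 F.
Proof.
rewrite /optimal /min_deficiency.
case: (@arg_minnP _ set0 xpredT (deficiency c f) isT) => F0 _ min0; split=> [E F' | o].
  by rewrite -!deficiency_total_cost E; have := min0 F' isT; lia.
apply/eqP; rewrite eqn_leq; apply/andP; split; last exact: min0.
by have := o F0; rewrite -!deficiency_total_cost; lia.
Qed.

Lemma colored_factorP F :
  colored_factor c f F <-> total_cost set0 (Phi F) = 0.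
Proof.
have ge0 v : 0 <= cost set0 v (Phi F v) by apply: cost_ge0; rewrite inE.
split=> [fac | tot v].
  by apply: big1 => v _; rewrite cost_out ?inE //; apply/JstarP.
apply/JstarP; rewrite -(cost_out (T := set0)) ?inE //.
by apply: (psumr_eq0P (fun u _ => ge0 u) tot).
Qed.

Lemma JstarN v m : exists2 h, Jstar f v h & h < m.
Proof.
exists (- (2 * `|m|%N%:Z + 1)); last by lia.
by apply/JstarP; rewrite /parity_dist; case: ifP; lia.
Qed.

Lemma DsetP v : Dset c f v <-> deficient set0 v.
Proof.
have v0 : v \notin set0 by rewrite inE.
split=> [nABC | [_ [F o below]]].
  have nA : ~ Aset c f v by move=> A; apply: nABC; left; left.
  have nC : ~ Cset c f v by move=> C; apply: nABC; right.
  have [F [o nJ]] : exists F, cost_optimal set0 F /\ ~ Jstar f v (Phi F v).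
    apply: boolp.contrapT => nex; apply: nC => x [F /optimalP o ->].
    by apply: boolp.contrapT => nJ; apply: nex; exists F.
  case: (boolP (strictly_below_even F v)) => below; first by split=> //; exists F.
  have gt : (f v)%:Z < Phi F v.
    move: nJ below => /JstarP; rewrite /parity_dist /strictly_below_even.
    by case: ifP; lia.
  (* Otherwise the least optimal degree at [v] is at least [f v], the maximum of [Jstar f v], which
     puts [v] in [Aset]. *)
  have [F' o' lt] : exists2 F', cost_optimal set0 F' & Phi F' v < (f v)%:Z.
    apply: boolp.contrapT => nex; apply: nA; split=> //.
    pose P F0 := boolp.asbool (cost_optimal set0 F0).
    have PF : P F by apply/boolp.asboolP.
    case: (@Order.TotalTheory.arg_minP _ _ _ F P (fun F0 => Phi F0 v) PF).
    move=> F0 /boolp.asboolP o0 min0; exists (Phi F0 v), (f v)%:Z; split.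
    - split=> [|x [F1 /optimalP o1 ->]]; first by exists F0 => //; apply/optimalP.
      by apply: min0; apply/boolp.asboolP.
    - split=> [|x Jx]; first by right.
      have {}Jx : (odd `|x|%N /\ x <= (f v)%:Z) \/ x = (f v)%:Z := Jx.
      by lia.
    - by rewrite leNgt; apply/negP => lt; apply: nex; exists F0.
  exact: deficient_of_both_sides o gt o' lt.
have IF : Iset c f v (Phi F v) by exists F => //; apply/optimalP.
move: below; rewrite /strictly_below_even => below.
case=> [[[_ [m [M [[_ minm] [_ maxM] leMm]]]] | [_ [M _ leM]]] | C].
- have := minm _ IF; have : (f v)%:Z <= M by apply: maxM; right.
  by lia.
- by have [h Jh lt] := JstarN v M; have := leM h Jh; lia.
- by have /JstarP := C _ IF; rewrite /parity_dist; case: ifP; lia.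
Qed.

(** * Criticality or a factor *)

Lemma connect_adjacent_minus0 : connected_graph G ->
  forall u v, connect (adjacent_minus set0) u v.
Proof.
move=> conn u v; rewrite (@eq_connect _ _ (@adjacent G)) // => x y.
by rewrite /adjacent_minus !inE.
Qed.

Lemma critical_total_cost_le1 F : Jstar_critical c f ->
  cost_optimal set0 F -> total_cost set0 (Phi F) <= 1.
Proof.
case=> conn DT o.
have dV v : deficient set0 v by apply/DsetP; rewrite DT.
have noA : no_surplus set0 by move=> v F0 _ _ _; apply: dV.
have := @exclusive_sum_le1 set0 [set: vertex G] F o (fun v _ => dV v).
rewrite /total_cost (eq_bigl predT) => [|v]; last by rewrite inE.
apply=> u v _ _.
exact: (deficient_connect noA (dV u) (connect_adjacent_minus0 conn u v)).2.
Qed.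

Lemma critical_or_factor : connected_graph G ->
  (forall T, T != set0 -> (odd_components T <= \sum_(v in T) f v)%N) ->
  Jstar_critical c f \/ exists F, colored_factor c f F.
Proof.
move=> conn tutte.
case: (boolp.pselect (exists F, colored_factor c f F)) => [|nfac]; first by right.
left; pose P T := [forall F, 0 < total_cost T (Phi F)].
have P0 : P set0.
  apply/forallP => F; rewrite lt_def; apply/andP; split.
    by apply/eqP => E; apply: nfac; exists F; apply/colored_factorP.
  by apply: sumr_ge0 => v _; apply: cost_ge0; rewrite inE.
case: (arg_maxnP (fun T => #|T|) P0) => T /forallP pos maxT.
(* A surplus vertex that is not deficient could be added to [T] by [linearise_cost], against
   maximality. *)
have noA : no_surplus T.
  move=> v F vT o gt; apply: boolp.contrapT => nd.
  have /maxT : P (v |: T).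
    apply/forallP => F'; apply: lt_le_trans (pos F) _.
    exact: linearise_cost.
  by rewrite cardsU1 vT /=; move: #|T| => k; lia.
have [F o] := exists_cost_optimal T.
have T0 : T = set0.
  apply/eqP; apply: boolp.contrapT => /negP /tutte le.
  have := total_cost_le_odd_components noA o; have := pos F.
  by move: (\sum_(_ in _) _)%N le => k; lia.
have [v vpos] : exists v, 0 < cost_at T F v.
  apply: boolp.contrapT => nex; have := pos F; apply/negP; rewrite -leNgt.
  apply: sumr_le0 => v _; rewrite leNgt; apply/negP => gt.
  by apply: nex; exists v.
have dv : deficient T v.
  by apply: positive_cost_deficient noA _ o vpos; rewrite T0 inE.
split=> //; apply: boolp.funext => u; apply: boolp.propext; split=> // _.
apply/DsetP; rewrite -T0; apply: (deficient_connect noA dv _).1.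
by rewrite T0; apply: connect_adjacent_minus0.
Qed.

End CostMinimisation.

(** * The coloring given by a vertex set *)

Section CutColoring.
Import Order.TTheory GRing.Theory Num.Theory.
Local Open Scope ring_scope.

Variables (G : graph) (f : vertex G -> nat) (S : {set vertex G}).
Hypothesis f_pos : forall v : vertex G, (0 < f v)%N.

Definition cut_coloring (e : edge G) (i : bool) : color :=
  if endpt e i \in S then Red else Green.

Lemma cut_coloring_ok : two_end_coloring cut_coloring.
Proof. by move=> e /eqP E; rewrite /cut_coloring E. Qed.

Local Notation Phi := (colored_degree cut_coloring).

Lemma cut_degree_le0 F v : v \notin S -> Phi F v <= 0.
Proof.
move=> vS; apply: sumr_le0 => e _.
have H i : (endpt e i == v)%:Z * color_sign (cut_coloring e i) <= 0.
  by case: eqP => [E | _]; rewrite ?mul0r // /cut_coloring E (negbTE vS).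
by rewrite (end_valueE cut_coloring_ok e v true); have := H true; have := H false;
  rewrite /=; lia.
Qed.

Lemma cut_signed_ends_ge0 F Y : 0 <= signed_ends cut_coloring F S Y.
Proof.
apply: sumr_ge0 => e _; apply: sumr_ge0 => i _; rewrite /cut_coloring.
by case: (endpt e i \in S); rewrite ?mul0r //= mulr1.
Qed.

(** Degrees off [S] are at most 0, hence below [f], so costs there only record parity. Each
    component contributes a nonnegative amount with the parity of its order. *)
Lemma cut_total_cost F :
  (odd_components S)%:Z - (\sum_(v in S) f v)%N%:Z <= total_cost f S (Phi F).
Proof.
rewrite (total_cost_split _ _ S S) (sum_cost_in _ cut_coloring_ok) //.
rewrite sum_components signed_ends_components odd_components_sum.
have in_ge0 := cut_signed_ends_ge0 F S.
have : \sum_(K in components_minus S) (odd #|K|)%:Z <=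
       \sum_(K in components_minus S) (signed_ends cut_coloring F S K
         + \sum_(v in K) cost_at cut_coloring f S F v).
  apply: ler_sum => K KP; have ends_ge0 := cut_signed_ends_ge0 F K.
  have costE v : v \in K -> cost_at cut_coloring f S F v
      = (~~ odd `|Phi F v|%N)%:Z.
    move=> vK; have vS := component_sub KP vK.
    rewrite /cost_at cost_out // /parity_dist.
    by have := cut_degree_le0 F vS; have := f_pos v; case: ifP; lia.
  have := component_parity cut_coloring_ok KP costE.
  have : 0 <= \sum_(v in K) cost_at cut_coloring f S F v.
    by apply: sumr_ge0 => v /costE ->.
  by move: (\sum_(_ in _) _) => r; case: (boolP (odd #|K|)); lia.
rewrite big_split /=.
by move: (\sum_(_ in _) _) (\sum_(_ in _) _) (\sum_(_ in _) _) in_ge0 => x y z; lia.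
Qed.

Lemma cut_total_cost0 F :
  total_cost f S (Phi F) <= total_cost f set0 (Phi F).
Proof.
apply: ler_sum => v _; rewrite /cost inE /parity_dist.
by case: ifP => _; case: ifP; lia.
Qed.

Lemma tutte_of_critical_or_factor : S != set0 ->
  Jstar_critical cut_coloring f \/
  (exists F, colored_factor cut_coloring f F) ->
  (odd_components S <= \sum_(v in S) f v)%N.
Proof.
move=> /set0Pn [a aS] crit; rewrite leqNgt; apply/negP => viol.
have pos F : 0 < total_cost f S (Phi F).
  by have := cut_total_cost F; move: (\sum_(_ in _) _)%N viol => k; lia.
case: crit => [crit | [F /colored_factorP tot]]; last first.
  by have := cut_total_cost0 F; have := pos F; rewrite tot; lia.
have /DsetP [] : Dset cut_coloring f a by rewrite crit.2.
  exact: cut_coloring_ok.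
(* The vertex [a] costs 1 in [F], but its linear cost is at most -1. Passing to the cost linearised
   on [S] thus lowers a total of at most 1 by at least 2, against [pos]. *)
move=> a0 [F o below].
have := critical_total_cost_le1 cut_coloring_ok crit o; have := pos F.
rewrite !(total_cost_split _ _ _ [set a]) !big_set1 (cost_below_even a0 below).
have : \sum_(v | v \notin [set a]) cost_at cut_coloring f S F v <=
       \sum_(v | v \notin [set a]) cost_at cut_coloring f set0 F v.
  apply: ler_sum => v _; rewrite /cost_at /cost inE /parity_dist.
  by case: ifP => _; case: ifP; lia.
move: below; rewrite /strictly_below_even /cost_at /cost aS.
by move: (\sum_(_ | _) _) (\sum_(_ | _) _) => x y; lia.
Qed.

End CutColoring.

Theorem theorem3p2 (G : graph) (f : vertex G -> nat)
    (conn_G : connected_graph G) (odd_G : odd #|vertex G|)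
    (f_pos : forall v : vertex G, 0 < f v) :
  (forall S : {set vertex G}, S != set0 ->
     odd_components S <= \sum_(v in S) f v)
  <->
  (forall c : edge G -> bool -> color, two_end_coloring c ->
     Jstar_critical c f \/
     exists F : {set edge G}, colored_factor c f F).
Proof.
split=> [tutte c c_ok | H S S0]; first exact: critical_or_factor.
by apply: tutte_of_critical_or_factor => //; apply: H; apply: cut_coloring_ok.
Qed.
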